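(* Let $B$ be an arbitrary set of positive integers. Then there exists an increasing sequence $(s_n)_{n\ge 1}$ of positive integers such that: (i) for every $g\in \mathbb{N}\setminus B$, the averages $\frac1N \sum_{n=1}^N e^{2\pi i s_n^g\alpha}$ converge as $N\to\infty$ for every real number $\alpha$; (ii) for every $b\in B$, there exists a real number $\alpha$ such that the averages $\frac1N \sum_{n=1}^N e^{2\pi i s_n^b\alpha}$ do not converge as $N\to\infty$.
   Context: $\mathbb{N}=\{1,2,3,\dots\}$. *)

(* Defs.v *)
From mathcomp Require Export all_boot all_order all_algebra.
From mathcomp Require Export all_classical all_reals all_analysis.
From mathcomp Require Export complex.

Set Implicit Arguments.
Unset Strict Implicit.
Unset Printing Implicit Defensive.

Import Order.TTheory GRing.Theory Num.Theory.
Import numFieldNormedType.Exports.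

Local Open Scope ring_scope.

(* [R[i]^o] is [R[i]] with the topology given by its complex modulus, under
   which convergence of sequences is stated below. *)

(* exp(2 pi i x) in Cartesian form. *)
Definition e2pi (R : realType) (x : R) : R[i]^o :=
  (cos (2 * pi * x) +i* sin (2 * pi * x))%C.

(* The value at [N = 0] is junk (the inverse of 0 is 0) and does not affect
   convergence. *)
Definition exp_avg (R : realType) (s : nat -> nat) (k : nat) (alpha : R)
    (N : nat) : R[i]^o :=
  N%:R^-1 * \sum_(1 <= n < N.+1) e2pi ((s n ^ k)%:R * alpha).

(* Main.v *)
Require Import Defs.
From mathcomp Require Import all_boot all_order all_algebra.
From mathcomp Require Import all_classical all_reals all_analysis.
From mathcomp Require Import complex.
From mathcomp Require Import zify ring lra.

(** If B is nonempty, the sequence enumerates a set A of positive integers of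
density 1/2 whose indicator is (1 + w)/2, for a weight w with values 1 and -1. If
B is empty, A is the set of all positive integers. Fix an irrational alpha and
write e(x) = exp(2 pi i x).

For one bad exponent b, take the weight n |-> S(n^b alpha), where S is the square
wave, the sign of sin (2 pi x). Its Fourier expansion has odd frequencies
only, so up to a small mean error it is a combination of the e(m n^b alpha) with
m nonzero. Against e(n^g beta) with g different from b, this gives Weyl sums of
m n^b alpha + n^g beta, and these have mean zero for every beta: either a leading
coefficient is irrational, or g > b and beta is rational, and then e(n^g beta) is
periodic and harmless ([weyl_two_powers], [sqwave_uncorrelated]). Against
e(n^b alpha) the weight does correlate, since
S(x) sin (2 pi x) = |sin (2 pi x)| >= sin (2 pi x)^2, which has mean 1/2.

Multiplying the weight by a sign which alternates between dyadic blocks preserves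
every mean zero statement ([mean_zero_block_sign]), and turns the correlation
with e(n^b alpha) into an oscillation, that is, into divergence of the averages.

An infinite set B is handled by giving the integers of 2-adic valuation k the
exponent tau k, where tau maps onto B. For a fixed beta, finitely many classes
are treated one at a time and the others have small total density, so no
uniformity in beta or in the exponent is needed ([weight_uncorrelated]). For b in
B, the classes with tau k = b all oscillate in phase, so no cancellation between
them can occur ([weight_correlated]).

Since A has positive density, averaging along its enumeration amounts to
averaging against its indicator ([averages_along_set]). The indicators, weights
and phases are indexed from 0, the index n standing for the integer n + 1. *)

Set Implicit Arguments.
Unset Strict Implicit.
Unset Printing Implicit Defensive.

Import Order.TTheory GRing.Theory Num.Theory.
Import numFieldNormedType.Exports.

Local Open Scope classical_set_scope.
Local Open Scope ring_scope.

Lemma sum_const_ord (V : pzRingType) (x : V) (n : nat) :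
  \sum_(i < n) x = n%:R * x.
Proof. by rewrite sumr_const card_ord mulr_natl. Qed.

(** * The modulus of a complex number as a real number *)

Section Modulus.
Variable R : realType.
Local Notation C := R[i].
Implicit Types (x y : R) (z : C).

(** The norm of [R[i]] takes its values in [R[i]], whose order is partial; the
real-valued modulus is accessible to linear arithmetic. *)
Definition cabs (z : C) : R := Normc.normc z.

Lemma cabsE z : `|z| = (cabs z)%:C%C.
Proof. by []. Qed.

Lemma cabs_ge0 z : 0 <= cabs z.
Proof. by case: z => a b; exact: sqrtr_ge0. Qed.

Lemma cabsD z1 z2 : cabs (z1 + z2) <= cabs z1 + cabs z2.
Proof. exact: le_normcD. Qed.

Lemma cabsN z : cabs (- z) = cabs z.
Proof. exact: normcN. Qed.

Lemma cabsB z1 z2 : cabs (z1 - z2) <= cabs z1 + cabs z2.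
Proof. by rewrite -(cabsN z2) cabsD. Qed.

Lemma cabsM z1 z2 : cabs (z1 * z2) = cabs z1 * cabs z2.
Proof. exact: Normc.normcM. Qed.

Lemma cabsV z : cabs z^-1 = (cabs z)^-1.
Proof. exact: Normc.normcV. Qed.

Lemma cabs0 : cabs 0 = 0.
Proof. exact: Normc.normc0. Qed.

Lemma cabs1 : cabs 1 = 1.
Proof. exact: Normc.normc1. Qed.

Lemma cabs_real x : cabs x%:C%C = `|x|.
Proof. by rewrite /cabs /= expr0n addr0 sqrtr_sqr. Qed.

Lemma cabs_nat n : cabs n%:R = n%:R.
Proof. by rewrite -(rmorph_nat (real_complex R)) cabs_real ger0_norm. Qed.

Lemma cabs_eq0 z : cabs z = 0 -> z = 0.
Proof. exact: Normc.eq0_normc. Qed.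

Lemma cabs_conj z : cabs (z^*)%C = cabs z.
Proof. by case: z => a b; rewrite /cabs /= sqrrN. Qed.

Lemma mul_conj z : z * (z^*)%C = (cabs z ^+ 2)%:C%C.
Proof. by rewrite -sqr_normc cabsE -rmorphXn. Qed.

Lemma cabs_sum (I : Type) (r : seq I) (P : pred I) (F : I -> C) :
  cabs (\sum_(i <- r | P i) F i) <= \sum_(i <- r | P i) cabs (F i).
Proof.
elim/big_ind2: _ => [|z a z2 a2 h1 h2|i _] //; first by rewrite cabs0.
by rewrite (le_trans (cabsD _ _))// lerD.
Qed.

Lemma cabs_sum_le (u : nat -> C) N : (forall n, cabs (u n) <= 1) ->
  cabs (\sum_(n < N) u n) <= N%:R.
Proof.
move=> u1; apply: (le_trans (cabs_sum _ _ _)).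
apply: (@le_trans _ _ (\sum_(n < N) 1)); first exact: ler_sum.
by rewrite sum_const_ord mulr1.
Qed.

Lemma ImD z1 z2 : complex.Im (z1 + z2) = complex.Im z1 + complex.Im z2.
Proof. by case: z1; case: z2. Qed.

Lemma ImN z : complex.Im (- z) = - complex.Im z.
Proof. by case: z. Qed.

Lemma Im_sum (I : Type) (r : seq I) (P : pred I) (F : I -> C) :
  complex.Im (\sum_(i <- r | P i) F i) = \sum_(i <- r | P i) complex.Im (F i).
Proof. by rewrite (big_morph (@complex.Im R) ImD (erefl _ : complex.Im (0 : C) = 0)). Qed.

Lemma ReD z1 z2 : complex.Re (z1 + z2) = complex.Re z1 + complex.Re z2.
Proof. by case: z1; case: z2. Qed.

Lemma Re_sum (I : Type) (r : seq I) (P : pred I) (F : I -> C) :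
  complex.Re (\sum_(i <- r | P i) F i) = \sum_(i <- r | P i) complex.Re (F i).
Proof. by rewrite (big_morph (@complex.Re R) ReD (erefl _ : complex.Re (0 : C) = 0)). Qed.

Lemma Re_le_cabs z : `|complex.Re z| <= cabs z.
Proof. by case: z => a b; rewrite /cabs /= -sqrtr_sqr ler_wsqrtr// lerDl sqr_ge0. Qed.

Lemma Im_le_cabs z : `|complex.Im z| <= cabs z.
Proof. by case: z => a b; rewrite /cabs /= -sqrtr_sqr ler_wsqrtr// lerDr sqr_ge0. Qed.

End Modulus.

(** * Sequences of mean zero *)

Section MeanZero.
Variable R : realType.
Local Notation C := R[i].
Implicit Types (f g u : nat -> C) (c L : C).

(** The partial sums of [f] are o(N). The additive constant [K] plays the role
of a threshold: such bounds add up with no need to compare thresholds. Having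
mean [L] is expressed as [mean_zero (fun n => f n - L)]. *)
Definition mean_zero f := forall eta : R, 0 < eta ->
  exists K : R, forall N : nat, cabs (\sum_(n < N) f n) <= eta * N%:R + K.

Lemma mean_zero_ext f g : f =1 g -> mean_zero f -> mean_zero g.
Proof. by move=> /funext ->. Qed.

Lemma mean_zero0 : mean_zero (fun=> 0).
Proof.
move=> eta eta0; exists 0 => N; rewrite big1// cabs0 addr0.
by rewrite mulr_ge0// ltW.
Qed.

Lemma mean_zeroD f g : mean_zero f -> mean_zero g -> mean_zero (fun n => f n + g n).
Proof.
move=> hf hg eta eta0.
have eta2 : 0 < eta / 2 by rewrite divr_gt0.
have [K hK] := hf _ eta2; have [K' hK'] := hg _ eta2.
exists (K + K') => N; rewrite big_split/= (le_trans (cabsD _ _))//.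
have := hK N; have := hK' N; lra.
Qed.

Lemma mean_zeroZ c f : mean_zero f -> mean_zero (fun n => c * f n).
Proof.
move=> hf eta eta0.
have c1 : 0 < cabs c + 1 by have := cabs_ge0 c; lra.
set t := eta / (cabs c + 1).
have et : eta = t * (cabs c + 1) by rewrite /t mulfVK// gt_eqF.
have t0 : 0 < t by rewrite divr_gt0.
have [K hK] := hf t t0.
exists (cabs c * K) => N; rewrite -mulr_sumr cabsM.
apply: (le_trans (ler_wpM2l (cabs_ge0 c) (hK N))).
have tN : 0 <= t * N%:R by rewrite mulr_ge0// ltW.
rewrite et; lra.
Qed.

Lemma mean_zeroN f : mean_zero f -> mean_zero (fun n => - f n).
Proof. by move=> /(mean_zeroZ (-1)); apply: mean_zero_ext => n; rewrite mulN1r. Qed.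

Lemma mean_zeroB f g : mean_zero f -> mean_zero g -> mean_zero (fun n => f n - g n).
Proof. by move=> hf /mean_zeroN; exact: mean_zeroD. Qed.

Lemma mean_zero_sum (I : Type) (r : seq I) (P : pred I) (F : I -> nat -> C) :
  (forall i, P i -> mean_zero (F i)) -> mean_zero (fun n => \sum_(i <- r | P i) F i n).
Proof.
move=> hF; elim: r => [|i r IH].
  by apply: mean_zero_ext mean_zero0 => n; rewrite big_nil.
case: (boolP (P i)) => Pi.
  by apply: mean_zero_ext (mean_zeroD (hF i Pi) IH) => n; rewrite big_cons Pi.
by apply: mean_zero_ext IH => n; rewrite big_cons (negbTE Pi).
Qed.

Lemma mean_zero_conj f : mean_zero f -> mean_zero (fun n => (f n)^*%C).
Proof.
move=> hf eta /hf [K hK]; exists K => N.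
by rewrite -(rmorph_sum (@conjc R)) cabs_conj.
Qed.

Lemma sum_shift f h N :
  \sum_(n < N) f (n + h)%N = \sum_(n < N + h) f n - \sum_(n < h) f n.
Proof.
rewrite addnC big_split_ord/= addrAC subrr add0r.
by apply: eq_bigr => i _; rewrite addnC.
Qed.

Lemma mean_zero_shift f h : mean_zero f -> mean_zero (fun n => f (n + h)%N).
Proof.
move=> hf eta eta0; have [K hK] := hf _ eta0.
exists (eta * h%:R + K + cabs (\sum_(n < h) f n)) => N.
rewrite sum_shift (le_trans (cabsB _ _))//.
have := hK (N + h)%N; rewrite natrD mulrDr; lra.
Qed.

Lemma mean_zero_bounded f (K : R) :
  (forall N, cabs (\sum_(n < N) f n) <= K) -> mean_zero f.
Proof.
move=> hK eta eta0; exists K => N; rewrite (le_trans (hK N))// lerDr.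
by rewrite mulr_ge0// ltW.
Qed.

(** The sequences of mean zero are closed for the seminorm given by the upper
mean of the modulus; this is what makes approximation by trigonometric
polynomials and truncation of the 2-adic classes possible. *)
Lemma mean_zero_approx f :
  (forall eta : R, 0 < eta -> exists2 g, mean_zero g & exists K : R, forall N,
     \sum_(n < N) cabs (f n - g n) <= eta * N%:R + K) ->
  mean_zero f.
Proof.
move=> hf eta eta0; have eta2 : 0 < eta / 2 by rewrite divr_gt0.
have [g /(_ _ eta2) [K hK] [K' hK']] := hf _ eta2.
exists (K + K') => N.
have -> : \sum_(n < N) f n = \sum_(n < N) g n + \sum_(n < N) (f n - g n).
  by rewrite -big_split/=; apply: eq_bigr => i _; rewrite addrC subrK.
rewrite (le_trans (cabsD _ _))//.
have := hK N; have := hK' N; have := cabs_sum (index_enum 'I_N) xpredT (fun n => f n - g n).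
lra.
Qed.

End MeanZero.

(** * The van der Corput inequality *)

Section VanDerCorput.
Variable R : realType.
Local Notation C := R[i].
Implicit Types (u : nat -> C).

(** Up to boundary terms, [H] times the sum of [u] is the sum of the window sums
[z n] of length [H]. The squared moduli of these expand into correlations, of
mean zero off the diagonal, so that [z n] is of order the square root of [H] on
average. With [H = K ^ 2] this saves a factor [K]. *)
Lemma van_der_corput u : (forall n, cabs (u n) <= 1) ->
  (forall h, (0 < h)%N -> mean_zero (fun n => u (n + h)%N * (u n)^*%C)) -> mean_zero u.
Proof.
move=> u1 hu eta eta0.
have [k hk] : exists k : nat, 2 / eta < k.+1%:R.
  exists (Num.truncn (2 / eta)).
  by have /andP[] := truncn_itv (ltW (divr_gt0 (ltr0n R 2) eta0)).
set K := k.+1 in hk; pose H := (K ^ 2)%N.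
have K0 : 0 < K%:R :> R by rewrite ltr0n.
pose z n := \sum_(h < H) u (n + h)%N.
pose p (h h' : 'I_H) n := if h == h' then 0 else u (n + h)%N * (u (n + h')%N)^*%C.
have hp h h' : mean_zero (p h h').
  rewrite /p; have [_|nhh] := eqVneq h h'; first exact: mean_zero0.
  have aux (a b : nat) : (b < a)%N -> mean_zero (fun n => u (n + a)%N * (u (n + b)%N)^*%C).
    move=> ba; have hab : (0 < a - b)%N by rewrite subn_gt0.
    apply: mean_zero_ext (mean_zero_shift b (hu _ hab)) => n.
    by rewrite -addnA subnKC// ltnW.
  have [|lt|/val_inj e] := ltngtP h h'; last by rewrite e eqxx in nhh.
  - move=> /aux/mean_zero_conj; apply: mean_zero_ext => n.
    by rewrite rmorphM/= conjcK mulrC.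
  - exact: aux.
pose q n := \sum_(h < H) \sum_(h' < H) p h h' n.
have hq : mean_zero q by apply: mean_zero_sum => h _; apply: mean_zero_sum => h' _; exact: hp.
have zz n : (cabs (z n) ^+ 2)%:C%C = q n + (\sum_(h < H) cabs (u (n + h)%N) ^+ 2)%:C%C.
  rewrite -mul_conj /z rmorph_sum/= mulr_suml /q rmorph_sum -big_split/=.
  apply: eq_bigr => h _; rewrite mulr_sumr (bigD1 h)//= [in RHS](bigD1 h)//=.
  rewrite /p eqxx add0r mul_conj addrC; congr (_ + _).
  by apply: eq_bigr => h' nh; rewrite eq_sym (negbTE nh).
have [D hD] := hq 1 ltr01.
have hz N : \sum_(n < N) cabs (z n) ^+ 2 <= (H%:R + 1) * N%:R + D.
  have -> : \sum_(n < N) cabs (z n) ^+ 2 = complex.Re (\sum_(n < N) q n)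
     + \sum_(n < N) \sum_(h < H) cabs (u (n + h)%N) ^+ 2.
    transitivity (complex.Re (\sum_(n < N) (cabs (z n) ^+ 2)%:C%C)).
      by rewrite Re_sum; apply: eq_bigr.
    rewrite !Re_sum -big_split/=; apply: eq_bigr => n _.
    by have /(congr1 (@complex.Re R)) := zz n; rewrite ReD.
  have le2 : \sum_(n < N) \sum_(h < H) cabs (u (n + h)%N) ^+ 2 <= H%:R * N%:R.
    apply: (@le_trans _ _ (\sum_(n < N) \sum_(h < H) 1)).
      by apply: ler_sum => n _; apply: ler_sum => h _; rewrite expr_le1// cabs_ge0.
    by rewrite !sumr_const !card_ord -natrM -mulrnA.
  have := hD N; have := Re_le_cabs (\sum_(n < N) q n).
  have := ler_norm (complex.Re (\sum_(n < N) q n)); lra.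
have hz1 N : cabs (\sum_(n < N) z n) <= (2 * K%:R) * N%:R + `|D|.
  apply: (le_trans (cabs_sum _ _ _)).
  (* The AM-GM inequality, at the expected size [K] of [z n]. *)
  have amgm : \sum_(n < N) cabs (z n) <=
      \sum_(n < N) ((2 * K%:R)^-1 * cabs (z n) ^+ 2 + K%:R / 2).
    apply: ler_sum => n _; rewrite -subr_ge0.
    have -> : (2 * K%:R)^-1 * cabs (z n) ^+ 2 + K%:R / 2 - cabs (z n) =
       (2 * K%:R)^-1 * (cabs (z n) - K%:R) ^+ 2.
      by field; rewrite gt_eqF.
    by rewrite mulr_ge0 ?sqr_ge0// invr_ge0; lra.
  apply: (le_trans amgm); rewrite big_split/= -mulr_sumr sum_const_ord [N%:R * _]mulrC.
  have i2 : 0 < (2 * K%:R)^-1 :> R by rewrite invr_gt0; lra.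
  have hz' := ler_wpM2l (ltW i2) (hz N).
  apply: le_trans (lerD hz' (lexx _)) _.
  have HK : H%:R = K%:R * K%:R :> R by rewrite /H natrX expr2.
  have K1 : 1 <= K%:R :> R by rewrite ler1n.
  have i2' : (2 * K%:R)^-1 <= 1 :> R by rewrite invf_le1; lra.
  have N0 : 0 <= N%:R :> R by [].
  have -> : (2 * K%:R)^-1 * ((H%:R + 1) * N%:R + D) =
    K%:R / 2 * N%:R + (2 * K%:R)^-1 * N%:R + (2 * K%:R)^-1 * D.
    by rewrite HK; field; rewrite gt_eqF.
  have a1 : (2 * K%:R)^-1 * N%:R <= K%:R * N%:R :> R.
    exact: (ler_wpM2r N0 (le_trans i2' K1)).
  have a2 : (2 * K%:R)^-1 * D <= `|D|.
    apply: (@le_trans _ _ ((2 * K%:R)^-1 * `|D|)).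
      by rewrite ler_wpM2l ?(ltW i2)// ler_norm.
    by rewrite ler_piMl.
  lra.
have shf h N : cabs (\sum_(n < N) u n - \sum_(n < N) u (n + h)%N) <= 2 * h%:R.
  have -> : \sum_(n < N) u n - \sum_(n < N) u (n + h)%N =
     \sum_(n < h) u n - \sum_(n < h) u (n + N)%N.
    by rewrite !sum_shift [(h + N)%N]addnC; ring.
  rewrite (le_trans (cabsB _ _))//.
  have := cabs_sum_le h u1; have := cabs_sum_le h (fun n => u1 (n + N)%N).
  lra.
have HK : H%:R = K%:R * K%:R :> R by rewrite /H natrX expr2.
have H0 : 0 < H%:R :> R by rewrite HK mulr_gt0.
exists (`|D| / H%:R + 2 * H%:R) => N.
have key : H%:R * cabs (\sum_(n < N) u n) <= (2 * K%:R) * N%:R + `|D| + 2 * H%:R * H%:R.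
  have -> : H%:R * cabs (\sum_(n < N) u n) = cabs (\sum_(h < H) \sum_(n < N) u n).
    by rewrite sum_const_ord cabsM cabs_nat.
  have -> : \sum_(h < H) \sum_(n < N) u n = \sum_(n < N) z n +
     \sum_(h < H) (\sum_(n < N) u n - \sum_(n < N) u (n + h)%N).
    rewrite /z [X in _ = X + _]exchange_big/= -big_split/=; apply: eq_bigr => h _.
    by rewrite addrC subrK.
  rewrite (le_trans (cabsD _ _))// lerD//.
  apply: (le_trans (cabs_sum _ _ _)).
  apply: (@le_trans _ _ (\sum_(h < H) (2 * H%:R))).
    apply: ler_sum => h _; apply: (le_trans (shf h N)).
    by rewrite ler_pM2l// ler_nat ltnW.
  by rewrite sum_const_ord mulrCA mulrA.
rewrite -(ler_pM2l H0); apply: (le_trans key).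
have -> : H%:R * (eta * N%:R + (`|D| / H%:R + 2 * H%:R)) =
  H%:R * eta * N%:R + `|D| + 2 * H%:R * H%:R by field; rewrite gt_eqF.
rewrite !lerD2r; apply: ler_wpM2r => //.
rewrite HK -mulrA mulrC ler_pM2l//.
by move: hk; rewrite ltr_pdivrMr// => /ltW.
Qed.

End VanDerCorput.

(** * The characters of the circle and an irrational angle *)

Section Cis.
Variable R : realType.
Local Notation C := R[i].
Implicit Types (x y a : R).

Definition cis x : C := e2pi x.

Lemma cisD x y : cis (x + y) = cis x * cis y.
Proof.
rewrite /cis /e2pi mulrDr cosD sinD; apply/eqP.
by rewrite eq_complex /= eqxx addrC eqxx.
Qed.

Lemma cis0 : cis 0 = 1.
Proof. by rewrite /cis /e2pi mulr0 cos0 sin0. Qed.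

Lemma cis_conj x : ((cis x)^*)%C = cis (- x).
Proof. by rewrite /cis /e2pi mulrN cosN sinN. Qed.

Lemma cabs_cis x : cabs (cis x) = 1.
Proof. by rewrite /cabs /= cos2Dsin2 sqrtr1. Qed.

Lemma cisMn n x : cis (n%:R * x) = cis x ^+ n.
Proof.
elim: n => [|n IH]; first by rewrite mul0r cis0 expr0.
by rewrite -natr1 mulrDl mul1r cisD IH exprSr.
Qed.

Lemma cisB x y : cis (x - y) = cis x * ((cis y)^*)%C.
Proof. by rewrite cis_conj cisD. Qed.

(** Irrationality of [a], stated through the circle: this is the only form in
which it enters the Weyl sums, and its negation directly gives periodicity. *)
Definition irrational_angle a := forall m : nat, (0 < m)%N -> cis (m%:R * a) <> 1.

Lemma irrational_angleMn a (n : nat) : (0 < n)%N -> irrational_angle a -> irrational_angle (n%:R * a).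
Proof.
by move=> n0 ha m m0; rewrite mulrA -natrM; apply: ha; rewrite muln_gt0 m0.
Qed.

Lemma irrational_angleN a : irrational_angle a -> irrational_angle (- a).
Proof.
move=> ha m m0; rewrite mulrN -cis_conj => /(congr1 (@conjc R)).
by rewrite conjcK rmorph1; exact: ha.
Qed.

Lemma irrational_angleMz a (z : int) : z != 0 -> irrational_angle a -> irrational_angle (z%:~R * a).
Proof.
case: z => n nz ha; first by apply: irrational_angleMn => //; rewrite lt0n.
by rewrite NegzE mulrNz mulNr; apply: irrational_angleN; exact: irrational_angleMn.
Qed.

(** The angle of (3 + 4i)/5 is irrational: (3 + 4i)^2 = -7 + 24i is congruent to
3 + 4i modulo 5, hence so are all powers of 3 + 4i, and none equals 5^m. *)
Lemma exists_irrational_angle : exists a, irrational_angle a.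
Proof.
pose t : R := acos (3 / 5).
have t35 : cos t = 3 / 5 by rewrite acosK// in_itv/=; lra.
have s45 : sin t = 4 / 5.
  rewrite sin_acos; last by lra.
  have -> : 1 - (3 / 5) ^+ 2 = (4 / 5) ^+ 2 :> R by field.
  by rewrite sqrtr_sqr ger0_norm//; lra.
have pi0 : pi != 0 :> R by rewrite gt_eqF// pi_gt0.
exists (t / (2 * pi)) => m m0.
rewrite cisMn.
have -> : cis (t / (2 * pi)) = ((3 / 5 : R) +i* (4 / 5))%C.
  by rewrite /cis /e2pi mulrC divfK ?mulf_neq0// t35 s45.
have key : exists x y : int,
    5 ^+ m * ((3 / 5 : R) +i* (4 / 5))%C ^+ m =
    ((5 * x + 3)%:~R +i* (5 * y + 4)%:~R)%C.
  elim: m m0 => // -[_ _|m /(_ isT) [x [y IH]] _].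
    exists 0, 0; rewrite !expr1.
    have -> : 5 = (5%:R : R)%:C%C :> C by rewrite rmorph_nat.
    apply/eqP; rewrite eq_complex /= !mul0r subr0 addr0 !mulr0 !add0r.
    by apply/andP; split; apply/eqP; field.
  exists (3 * x - 4 * y - 2), (4 * x + 3 * y + 4).
  rewrite exprS [X in _ * X]exprS mulrACA IH.
  have -> : 5 = (5%:R : R)%:C%C :> C by rewrite rmorph_nat.
  apply/eqP; rewrite eq_complex /=.
  by apply/andP; split; apply/eqP; rewrite !(rmorphD, rmorphM, rmorphB)/=; field.
move=> e1; have [x [y]] := key; rewrite e1 mulr1.
have -> : 5 ^+ m = (5 ^+ m : R)%:C%C :> C by rewrite rmorphXn rmorph_nat.
move=> /(congr1 (@complex.Im R)) /= /esym/eqP.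
by rewrite intr_eq0 => /eqP; lia.
Qed.

End Cis.

(** * Weyl sums with a periodic factor *)

Section Weyl.
Variable R : realType.
Local Notation C := R[i].
Implicit Types (f : nat -> R) (a c : R) (chi : nat -> C).

(** The [d]-th iterated differences of [f] are the multiples of [a] by the
product of the steps: [f] is a polynomial of degree at most [d] with coefficient
a / d! in degree [d]. This form is the one which differencing consumes. *)
Fixpoint poly_phase d a f : Prop :=
  if d is d'.+1 then forall h, poly_phase d' (h%:R * a) (fun n => f (n + h)%N - f n)
  else forall n, f n = a.

Lemma poly_phase_shift d a f k :
  poly_phase d a f -> poly_phase d a (fun n => f (n + k)%N).
Proof.
elim: d a f => [|d IH] a f hf; first by move=> n; exact: hf.
move=> h; have := IH _ _ (hf h).
by congr poly_phase; apply/funext => n; rewrite addnAC.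
Qed.

Lemma poly_phaseD d a a' f f' : poly_phase d a f -> poly_phase d a' f' ->
  poly_phase d (a + a') (fun n => f n + f' n).
Proof.
elim: d a a' f f' => [|d IH] a a' f f' hf hf'; first by move=> n; rewrite hf hf'.
move=> h; have := IH _ _ _ _ (hf h) (hf' h); rewrite -mulrDr.
by congr poly_phase; apply/funext => n; ring.
Qed.

Lemma poly_phaseZ d a f c : poly_phase d a f ->
  poly_phase d (c * a) (fun n => c * f n).
Proof.
elim: d a f => [|d IH] a f hf; first by move=> n; rewrite hf.
move=> h; have := IH _ _ (hf h); rewrite mulrCA.
by congr poly_phase; apply/funext => n; rewrite mulrBr.
Qed.

Lemma poly_phase_lift d a f : poly_phase d a f -> poly_phase d.+1 0 f.
Proof.
elim: d a f => [|d IH] a f hf h; first by move=> n; rewrite !hf subrr mulr0.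
by rewrite mulr0; apply: IH (hf h).
Qed.

Lemma poly_phase_widen d d' a f : (d < d')%N -> poly_phase d a f ->
  poly_phase d' 0 f.
Proof.
elim: d' => // d' IH; rewrite ltnS leq_eqVlt => /orP[/eqP <-|/IH{}IH] hf.
  exact: poly_phase_lift hf.
exact: poly_phase_lift (IH hf).
Qed.

(** The Leibniz rule for the difference of step [h]:
(n + 1 + h) f(n + h) - (n + 1) f(n) = (n + 1) (f(n + h) - f(n)) + h f(n + h). *)
Lemma poly_phase_mul d a f : poly_phase d a f ->
  poly_phase d.+1 (d.+1%:R * a) (fun n => n.+1%:R * f n).
Proof.
elim: d a f => [|d IH] a f hf h.
  by move=> n; rewrite !hf -mulrBl mul1r -addSn natrD addrAC subrr add0r.
have h1 := IH _ _ (hf h); have h2 := poly_phaseZ h%:R (poly_phase_shift h hf).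
have h3 : poly_phase d.+1 (h%:R * a) (fun n => h%:R * f (n + h)%N).
  exact: h2.
have := poly_phaseD h1 h3.
have -> : d.+1%:R * (h%:R * a) + h%:R * a = h%:R * (d.+2%:R * a).
  by rewrite -[d.+2%:R]natr1; ring.
congr poly_phase; apply/funext => n; rewrite -addSn natrD; ring.
Qed.

Lemma poly_phase_pow d : poly_phase d d`!%:R (fun n => (n.+1 ^ d)%:R).
Proof.
elim: d => [|d IH]; first by [].
have := poly_phase_mul IH; rewrite -natrM -factS.
by congr poly_phase; apply/funext => n; rewrite -natrM -expnS.
Qed.

Definition periodic_seq M chi := (0 < M)%N /\ forall n, chi (n + M)%N = chi n.

Lemma periodic_seqM M M' chi chi' : periodic_seq M chi -> periodic_seq M' chi' ->
  periodic_seq (M * M') (fun n => chi n * chi' n).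
Proof.
move=> [M0 hM] [M'0 hM']; split; first by rewrite muln_gt0 M0.
have mult k K psi n : (forall n, psi (n + K)%N = psi n :> C) ->
    psi (n + k * K)%N = psi n.
  by move=> hK; elim: k => [|k IH]; rewrite ?addn0// mulSn addnCA addnC hK.
by move=> n; rewrite (mult _ _ chi')// mulnC mult.
Qed.

(** Van der Corput differencing lowers the degree and multiplies [a] by [h],
which keeps it irrational, while the periodic factors chi (n + h) and the
conjugate of chi n multiply to a periodic factor. In degree 1, translation by the
period multiplies the sequence by a constant other than 1, hence its partial sums
are bounded, like those of a geometric sequence. *)
Lemma weyl d a f M chi : irrational_angle a -> poly_phase d.+1 a f -> periodic_seq M chi ->
  (forall n, cabs (chi n) <= 1) -> mean_zero (fun n => chi n * cis (f n)).
Proof.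
elim: d a f M chi => [|d IH] a f M chi ha hf [M0 hchi] chi1.
  set u := fun n => _.
  have u1 n : cabs (u n) <= 1 by rewrite /u cabsM cabs_cis mulr1.
  have zeta : cis (M%:R * a) - 1 != 0 by rewrite subr_eq0; apply/eqP; exact: ha.
  have uM n : u (n + M)%N = cis (M%:R * a) * u n.
    by rewrite /u hchi -(hf M n) cisB mulrCA -mulrA [((cis _)^*)%C * _]mulrC mul_conj
      cabs_cis expr1n mulr1.
  apply: (@mean_zero_bounded _ _ (2 * M%:R / cabs (cis (M%:R * a) - 1))) => N.
  have z0 : 0 < cabs (cis (M%:R * a) - 1).
    rewrite lt_neqAle cabs_ge0 andbT eq_sym; apply: contra zeta => /eqP.
    by move/cabs_eq0 => ->.
  rewrite ler_pdivlMr// mulrC -cabsM mulrBl mul1r mulr_sumr.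
  under [X in X - _]eq_bigr do rewrite -uM.
  have -> : \sum_(n < N) u (n + M)%N - \sum_(n < N) u n =
     \sum_(n < M) u (n + N)%N - \sum_(n < M) u n.
    by rewrite !sum_shift [(M + N)%N]addnC; ring.
  rewrite (le_trans (cabsB _ _))//.
  have := cabs_sum_le M u1; have := cabs_sum_le M (fun n => u1 (n + N)%N); lra.
apply: van_der_corput => [n|h h0]; first by rewrite cabsM cabs_cis mulr1.
have hpsi : periodic_seq M (fun n => chi (n + h)%N * ((chi n)^*)%C).
  by split => // n; rewrite addnAC !hchi.
have hpsi1 n : cabs (chi (n + h)%N * ((chi n)^*)%C) <= 1.
  by rewrite cabsM cabs_conj mulr_ile1 ?cabs_ge0.
apply: mean_zero_ext (IH _ _ _ _ (irrational_angleMn h0 ha) (hf h) hpsi hpsi1) => n.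
by rewrite cisB rmorphM/=; ring.
Qed.

(** After subtraction of the mean over a period, the partial sums are periodic
and so bounded. *)
Lemma periodic_mean M chi : periodic_seq M chi ->
  mean_zero (fun n => chi n - M%:R^-1 * \sum_(i < M) chi i).
Proof.
move=> [M0 hM]; set L := _ * _; pose u n := chi n - L.
have uM n : u (n + M)%N = u n by rewrite /u hM.
have SM : \sum_(n < M) u n = 0.
  rewrite /u big_split/= sumrN sum_const_ord /L mulVKf ?subrr//.
  by rewrite pnatr_eq0 -lt0n.
apply: (@mean_zero_bounded _ _ (\sum_(n < M) cabs (u n))) => N.
elim/ltn_ind: N => N IH; have [NM|MN] := ltnP N M.
  apply: (le_trans (cabs_sum _ _ _)).
  rewrite -(subnKC (ltnW NM)) big_split_ord/= lerDl.
  by rewrite sumr_ge0// => i _; exact: cabs_ge0.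
have -> : \sum_(n < N) u n = \sum_(n < N - M) u n.
  have := sum_shift u M (N - M); rewrite subnK// SM subr0 => <-.
  by apply: eq_bigr => i _; exact: uM.
by apply: IH; rewrite ltn_subrL M0 (leq_trans M0).
Qed.

Lemma cis_pow_periodic m g a : (0 < m)%N -> cis (m%:R * a) = 1 ->
  periodic_seq m (fun n => cis ((n.+1 ^ g)%:R * a)).
Proof.
move=> m0 ma; split => // n.
have [k ->] : exists k, ((n + m).+1 ^ g = n.+1 ^ g + k * m)%N.
  elim: g => [|g [k IH]]; first by exists 0%N.
  exists (n.+1 ^ g + n.+1 * k + k * m)%N; rewrite expnS IH expnS; nia.
rewrite natrD mulrDl cisD -[RHS]mulr1; congr (_ * _).
by rewrite natrM -mulrA cisMn ma expr1n.
Qed.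

Lemma irrational_angle_or_period a : irrational_angle a \/ exists2 m, (0 < m)%N & cis (m%:R * a) = 1.
Proof.
have [|ha] := pselect (exists2 m, (0 < m)%N & cis (m%:R * a) = 1); first by right.
by left => m m0 e; apply: ha; exists m.
Qed.

(** The full Weyl averages: the mean is 0 for irrational [a] and positive
degree, and otherwise the sequence is periodic. *)
Lemma weyl_mean g a : exists L, mean_zero (fun n => cis ((n.+1 ^ g)%:R * a) - L).
Proof.
have [ha|[m m0 ma]] := irrational_angle_or_period a; last first.
  by eexists; exact: (periodic_mean (cis_pow_periodic g m0 ma)).
case: g => [|g].
  by exists (cis a); apply: mean_zero_ext (@mean_zero0 R) => n; rewrite expn0 mul1r subrr.
exists 0; have h := poly_phaseZ a (poly_phase_pow g.+1).
have hirr : irrational_angle (a * g.+1`!%:R) by rewrite mulrC; apply: irrational_angleMn; rewrite ?fact_gt0.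
have h1 : periodic_seq 1 (fun=> 1 : C) by [].
apply: mean_zero_ext (weyl hirr h h1 _) => n; last by rewrite cabs1.
by rewrite mul1r subr0 mulrC.
Qed.

(** If [b] is the larger exponent, or if [beta] is irrational, the leading
coefficient of the phase is irrational. Otherwise the power with exponent [g] is
periodic modulo 1 and is absorbed into the periodic factor, so that the power
with exponent [b] leads again. *)
Lemma weyl_two_powers M chi b g (alpha beta : R) (z : int) :
  periodic_seq M chi -> (forall n, cabs (chi n) <= 1) ->
  (0 < b)%N -> g != b -> irrational_angle alpha -> z != 0 ->
  mean_zero (fun n => chi n * cis (z%:~R * ((n.+1 ^ b)%:R * alpha))
                      * cis ((n.+1 ^ g)%:R * beta)).
Proof.
move=> hM chi1 b0 gb halpha z0.
pose fb n : R := z%:~R * ((n.+1 ^ b)%:R * alpha).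
pose fg n : R := (n.+1 ^ g)%:R * beta.
have hfb : poly_phase b (z%:~R * (b`!%:R * alpha)) fb.
  have := poly_phaseZ z%:~R (poly_phaseZ alpha (poly_phase_pow b)).
  by rewrite [alpha * _]mulrC; congr poly_phase; apply/funext => n; rewrite [alpha * _]mulrC.
have hfg : poly_phase g (g`!%:R * beta) fg.
  have := poly_phaseZ beta (poly_phase_pow g).
  by rewrite [beta * _]mulrC; congr poly_phase; apply/funext => n; rewrite [beta * _]mulrC.
have irrb : irrational_angle (z%:~R * (b`!%:R * alpha)).
  by apply: irrational_angleMz => //; apply: irrational_angleMn; rewrite ?fact_gt0.
have [b' eb] : exists b', b = b'.+1 by exists b.-1; rewrite prednK.
have [gltb|bltg|e] := ltngtP g b; last by rewrite e eqxx in gb.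
  have h := poly_phaseD hfb (poly_phase_widen gltb hfg).
  rewrite addr0 {1}eb in h.
  by apply: mean_zero_ext (weyl irrb h hM chi1) => n; rewrite cisD mulrA.
have [hbeta|[m m0 mbeta]] := irrational_angle_or_period beta.
  have h := poly_phaseD (poly_phase_widen bltg hfb) hfg.
  rewrite add0r in h.
  have irrg : irrational_angle (g`!%:R * beta) by apply: irrational_angleMn; rewrite ?fact_gt0.
  have [g' eg] : exists g', g = g'.+1 by exists g.-1; rewrite prednK// (leq_trans _ bltg).
  rewrite {1}eg in h.
  by apply: mean_zero_ext (weyl irrg h hM chi1) => n; rewrite cisD mulrA.
have hM' := periodic_seqM hM (cis_pow_periodic g m0 mbeta).
rewrite {1}eb in hfb.
apply: mean_zero_ext (weyl irrb hfb hM' _) => n; first by rewrite mulrAC.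
by rewrite cabsM cabs_cis mulr1.
Qed.

End Weyl.

(** * The square wave and its approximation by trigonometric polynomials *)

Section SquareWave.
Variable R : realType.
Local Notation C := R[i].
Implicit Types (x y alpha beta : R) (chi : nat -> C).

Definition sqwave x : R := if 0 <= sin (2 * pi * x) then 1 else -1.

(** Iteration of this odd cubic pushes every point of ]0, 1] to 1 and every
point of [-1, 0[ to -1, so its iterates at sin (2 pi x) are trigonometric
polynomials that tend to the square wave. *)
Definition sharpen y : R := y * (3 - y ^+ 2) / 2.

Lemma sharpen_bounds y : 0 <= y <= 1 -> 0 <= sharpen y <= 1.
Proof.
move=> /andP[y0 y1]; rewrite /sharpen; apply/andP; split; first by nra.
rewrite -subr_ge0.
have -> : 1 - y * (3 - y ^+ 2) / 2 = (1 - y) ^+ 2 * (2 + y) / 2 by field.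
by rewrite divr_ge0// mulr_ge0 ?sqr_ge0// addr_ge0.
Qed.

Lemma sharpenN y : sharpen (- y) = - sharpen y.
Proof. by rewrite /sharpen; field. Qed.

(** With t = 1 - y^2, the new gap is t^2 (3 + t)/4. *)
Lemma sharpen_gap y : 0 <= y <= 1 -> 1 - sharpen y ^+ 2 <= (1 - y ^+ 2) ^+ 2.
Proof.
move=> /andP[y0 y1]; set t := 1 - y ^+ 2.
have t01 : 0 <= t <= 1 by rewrite /t; apply/andP; split; nra.
have -> : 1 - sharpen y ^+ 2 = t ^+ 2 * (3 + t) / 4 by rewrite /sharpen /t; field.
by have := sqr_ge0 t; move: t01 => /andP[t0 t1]; nra.
Qed.

Lemma iter_sharpen j y : 0 <= y <= 1 -> 0 <= iter j sharpen y <= 1 /\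
  1 - iter j sharpen y ^+ 2 <= (1 - y ^+ 2) ^+ (2 ^ j).
Proof.
move=> y01; elim: j => [|j [h01 hj]]; first by rewrite /= expr1.
rewrite iterS; split; first exact: sharpen_bounds.
apply: (le_trans (sharpen_gap h01)); rewrite expnSr exprM.
move: h01 => /andP[h0 h1].
by rewrite ler_pXn2r// nnegrE; nra.
Qed.

Lemma iter_sharpenN j y : iter j sharpen (- y) = - iter j sharpen y.
Proof. by elim: j => // j IH; rewrite !iterS IH sharpenN. Qed.

(** The error 1 - |T| of the iterate T is at most 1 - T^2, and this gap is at
least squared at each step. The bound is itself a trigonometric polynomial, whose
mean is explicit. *)
Lemma sqwave_approx j x :
  `|sqwave x - iter j sharpen (sin (2 * pi * x))| <=
    (cos (2 * pi * x) ^+ 2) ^+ (2 ^ j).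
Proof.
rewrite /sqwave; set t := 2 * pi * x.
have -> : cos t ^+ 2 = 1 - sin t ^+ 2 by rewrite cos2sin2.
have [s1 s2] := (sin_geN1 t, sin_le1 t).
case: ifPn => [s0|]; last rewrite -ltNge => s0.
  have [|h01 hj] := @iter_sharpen j (sin t); first by rewrite s0.
  apply: le_trans hj; move: h01 => /andP[h0 h1].
  by rewrite ger0_norm ?subr_ge0//; nra.
have [|h01 hj] := @iter_sharpen j (- sin t); first by apply/andP; split; lra.
rewrite sqrrN in hj; apply: le_trans hj; move: h01 => /andP[].
rewrite iter_sharpenN; set w := iter _ _ _ => h0 h1.
by rewrite ler0_norm; nra.
Qed.

Lemma sin_cis x :
  (sin (2 * pi * x))%:C%C = cis (- x) * ((2 * 'i%C)^-1 * (cis (2 * x) - 1)).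
Proof.
have i0 : 2 * 'i%C != 0 :> C by rewrite mulf_neq0// ?pnatr_eq0// eq_complex /= oner_eq0 andbF.
have -> : cis (2 * x) = cis x * cis x by rewrite -cisD; congr cis; ring.
have e1 : cis (- x) * cis x = 1 by rewrite -cisD addNr cis0.
apply: (mulfI i0); rewrite [RHS]mulrCA mulVKf// mulrBr mulr1 mulrA e1 mul1r.
rewrite -cis_conj /cis /e2pi; set t := 2 * pi * x.
have -> : 2 = (2%:R : R)%:C%C :> C by rewrite rmorph_nat.
by apply/eqP; rewrite eq_complex /=; apply/andP; split; apply/eqP; ring.
Qed.

Lemma cos_cis x :
  (cos (2 * pi * x))%:C%C = cis (- x) * (2^-1 * (cis (2 * x) + 1)).
Proof.
have i0 : 2 != 0 :> C by rewrite pnatr_eq0.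
have -> : cis (2 * x) = cis x * cis x by rewrite -cisD; congr cis; ring.
have e1 : cis (- x) * cis x = 1 by rewrite -cisD addNr cis0.
apply: (mulfI i0); rewrite [RHS]mulrCA mulVKf// [RHS]mulrDr mulr1 mulrA e1 mul1r.
rewrite -cis_conj /cis /e2pi; set t := 2 * pi * x.
have -> : 2 = (2%:R : R)%:C%C :> C by rewrite rmorph_nat.
by apply/eqP; rewrite eq_complex /=; apply/andP; split; apply/eqP; ring.
Qed.

(** The iterates are Laurent polynomials in e(x) with odd frequencies only; in
particular they have no constant term. *)
Lemma iter_sharpen_trig j : exists (L : nat) (P : {poly C}), forall x,
  (iter j sharpen (sin (2 * pi * x)))%:C%C =
  cis (- (L.*2.+1%:R * x)) * P.[cis (2 * x)].
Proof.
elim: j => [|j [L [P IH]]].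
  exists 0%N, ((2 * 'i%C)^-1 *: ('X - 1)) => x.
  by rewrite mul1r !hornerE/= sin_cis mulrA.
exists (3 * L + 1)%N, (2^-1 *: (3%:R *: 'X^(L.*2.+1) * P - P ^+ 3)) => x.
have -> : cis (- ((3 * L + 1).*2.+1%:R * x)) = cis (- (L.*2.+1%:R * x)) ^+ 3.
  have -> : ((3 * L + 1).*2.+1 = 3 * L.*2.+1)%N by lia.
  by rewrite -cisMn natrM mulrN mulrA.
have e1 : cis (- (L.*2.+1%:R * x)) ^+ 2 * cis (2 * x) ^+ L.*2.+1 = 1.
  by rewrite -!cisMn -cisD -[RHS]cis0; congr cis; ring.
have := IH x; set y := iter j _ _ => IHx; rewrite iterS -/y /sharpen.
have -> : (y * (3 - y ^+ 2) / 2)%:C%C =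
    2^-1 * (3%:R * y%:C%C - y%:C%C ^+ 3) :> C.
  rewrite -(rmorph_nat (real_complex R) 2) -(rmorph_nat (real_complex R) 3).
  rewrite -fmorphV -!rmorphXn -!rmorphM -!rmorphB -!rmorphM /=.
  by congr (_%:C)%C; ring.
rewrite IHx !hornerE/= ; set u := cis (- _) in e1 *; set v := P.[_].
set w := cis (2 * x) ^+ _ in e1 *.
(* [u ^+ 2 * w = 1] brings the linear term to the frequencies of the cubic one. *)
transitivity (2^-1 * (3%:R * (u * v) * (u ^+ 2 * w) - (u * v) ^+ 3)); last by ring.
by rewrite e1 mulr1 mulrA.
Qed.

(** The frequencies are even here, and the constant term is the one of index
[K]: the central binomial coefficient over 4^K. *)
Lemma cos_pow_trig K x : ((cos (2 * pi * x) ^+ 2) ^+ K)%:C%C =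
  cis (- (K.*2%:R * x)) *
    (\poly_(i < K.*2.+1) (('C(K.*2, i))%:R / 4 ^+ K)).[cis (2 * x)].
Proof.
rewrite horner_poly -exprM mul2n rmorphXn/= cos_cis.
rewrite exprMn -cisMn mulrN; congr (_ * _).
have -> : (2^-1 * (cis (2 * x) + 1)) ^+ K.*2 =
    (4 ^+ K)^-1 * (1 + cis (2 * x)) ^+ K.*2.
  rewrite exprMn [cis _ + 1]addrC exprVn -mul2n exprM.
  by have -> : 2 ^+ 2 = 4 :> C by rewrite -natrX.
rewrite [(1 + cis _) ^+ _]exprDn mulr_sumr; apply: eq_bigr => i _.
by rewrite expr1n mul1r -[_ *+ 'C(_, _)]mulr_natl mulrA [_ * _%:R]mulrC.
Qed.

(** The Wallis-type bound by 1 / sqrt (2K + 1), squared to allow induction. *)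
Lemma central_bin_small K :
  (('C(K.*2, K))%:R / 4 ^+ K) ^+ 2 * (K.*2.+1)%:R <= 1 :> R.
Proof.
elim: K => [|K IH]; first by rewrite bin0 expr0 divr1 expr1n mul1r.
have h : (K.+1 * 'C(K.+1.*2, K.+1) = 2 * K.*2.+1 * 'C(K.*2, K))%N.
  have h1 := mul_bin_diag K.+1.*2 K; have h2 := mul_bin_down K.*2.+1 K.
  rewrite /= in h1 h2; have e : (K.*2.+1 - K = K.+1)%N by lia.
  rewrite e in h2; nia.
have -> : ('C(K.+1.*2, K.+1))%:R = 2 * (K.*2.+1)%:R * ('C(K.*2, K))%:R / (K.+1)%:R :> R.
  by rewrite -!natrM -h natrM mulrC mulKf// pnatr_eq0.
set c := _ / _ in IH; set k : R := K%:R.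
have k0 : 0 <= k by rewrite /k.
have ek : (K.*2.+1)%:R = 2 * k + 1 by rewrite -addn1 natrD -mul2n natrM.
have ek' : (K.+1.*2.+1)%:R = 2 * k + 3.
  by rewrite doubleS -addn3 natrD -mul2n natrM.
have ek1 : (K.+1)%:R = k + 1 by rewrite -addn1 natrD.
rewrite ek ek' ek1; rewrite ek in IH.
have -> : 2 * (2 * k + 1) * ('C(K.*2, K))%:R / (k + 1) / 4 ^+ K.+1 =
   (2 * k + 1) / (2 * (k + 1)) * c.
  by rewrite /c exprS; field; rewrite !gt_eqF ?exprn_gt0//; lra.
rewrite exprMn -mulrA.
have q : ((2 * k + 1) / (2 * (k + 1))) ^+ 2 * (2 * k + 3) <= 2 * k + 1.
  rewrite expr_div_n mulrAC ler_pdivrMr; last by apply: exprn_gt0; lra.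
  by nra.
have c2 := sqr_ge0 c.
rewrite [c ^+ 2 * _]mulrC mulrA; apply: le_trans IH; rewrite mulrC.
exact: ler_wpM2l.
Qed.

(** A Laurent polynomial in e(x), sampled at x = (n + 1)^b alpha, may be replaced
by its constant term, also against a periodic sequence and a power phase of
another exponent. The frequencies are 2 i - l, so that a constant
term exists only for even [l]. *)
Lemma trig_poly_mean (l : nat) (P : {poly C}) M chi b g alpha beta :
  periodic_seq M chi -> (forall n, cabs (chi n) <= 1) ->
  (0 < b)%N -> g != b -> irrational_angle alpha ->
  mean_zero (fun n => chi n * (cis (- (l%:R * ((n.+1 ^ b)%:R * alpha))) *
      P.[cis (2 * ((n.+1 ^ b)%:R * alpha))] -
      (if odd l then 0 else P`_l./2)) * cis ((n.+1 ^ g)%:R * beta)).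
Proof.
move=> hM chi1 b0 gb ha.
pose F (i : nat) n := if i.*2 == l then 0 else
  P`_i * (chi n * cis ((i.*2%:Z - l%:Z)%:~R * ((n.+1 ^ b)%:R * alpha))
      * cis ((n.+1 ^ g)%:R * beta)).
have hF i : mean_zero (F i).
  rewrite /F; case: eqVneq => [_|il]; first exact: mean_zero0.
  by apply: mean_zeroZ; apply: (weyl_two_powers _ hM) => //; rewrite subr_eq0 eqz_nat.
have := @mean_zero_sum _ _ (index_iota 0 (maxn (size P) l.+1)) xpredT F (fun i _ => hF i).
apply: mean_zero_ext => n; set x := _ * alpha; set v := cis (_ * beta).
rewrite (@horner_coef_wide _ (maxn (size P) l.+1)) ?leq_maxl//.
rewrite -(big_mkord xpredT (fun i => P`_i * cis (2 * x) ^+ i)).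
have xi i : cis (- (l%:R * x)) * cis (2 * x) ^+ i =
    cis ((i.*2%:Z - l%:Z)%:~R * x).
  rewrite -cisMn -cisD; congr cis; rewrite rmorphB/= -mul2n -!pmulrn natrM; ring.
have [ol|el] := boolP (odd l).
  rewrite subr0 !mulr_sumr mulr_suml; apply: eq_bigr => i _; rewrite /F -/x -/v.
  case: eqVneq => [il|_]; first by rewrite -il odd_double in ol.
  by rewrite -xi; ring.
have lin : (l./2 \in index_iota 0 (maxn (size P) l.+1))%N.
  rewrite mem_index_iota; lia.
have l2 : (l./2).*2 = l by rewrite -{2}(odd_double_half l) (negbTE el).
rewrite (bigD1_seq l./2)//= ?iota_uniq// [in RHS](bigD1_seq l./2)//= ?iota_uniq//.
have -> : F l./2 n = 0 by rewrite /F l2 eqxx.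
rewrite add0r [cis (- _) * (_ + _)]mulrDr [cis (- _) * (P`_ _ * _)]mulrCA xi l2.
rewrite subrr mul0r cis0 mulr1 [X in _ * (X - _)]addrC addrK.
rewrite !mulr_sumr mulr_suml; apply: eq_bigr => i il.
rewrite /F -/x -/v; case: eqVneq => [e|_].
  by rewrite -e doubleK eqxx in il.
by rewrite -xi; ring.
Qed.

Lemma cos_pow_mean K b alpha : (0 < b)%N -> irrational_angle alpha ->
  mean_zero (fun n => ((cos (2 * pi * ((n.+1 ^ b)%:R * alpha)) ^+ 2) ^+ K)%:C%C
      - (('C(K.*2, K))%:R / 4 ^+ K)%:C%C).
Proof.
move=> b0 ha.
have h1 : periodic_seq 1 (fun=> 1 : C) by [].
have g0 : 0%N != b by rewrite neq_ltn b0.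
have := @trig_poly_mean K.*2 (\poly_(i < K.*2.+1) (('C(K.*2, i))%:R / 4 ^+ K))
  1 _ b 0 alpha 0 h1 (fun=> _) b0 g0 ha.
rewrite cabs1 => /(_ (fun=> lexx _)); apply: mean_zero_ext => n.
rewrite mulr0 cis0 mulr1 mul1r -cos_pow_trig odd_double doubleK coef_poly.
rewrite ltnS -addnn leq_addr; congr (_ - _).
by rewrite addnn fmorph_div rmorphXn !rmorph_nat.
Qed.

(** The square wave is replaced by an iterate of [sharpen], without constant
term; the mean of the error is at most that of a high power of the squared
cosine. *)
Lemma sqwave_uncorrelated M chi b g alpha beta :
  periodic_seq M chi -> (forall n, cabs (chi n) <= 1) ->
  (0 < b)%N -> g != b -> irrational_angle alpha ->
  mean_zero (fun n => chi n * (sqwave ((n.+1 ^ b)%:R * alpha))%:C%C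
                      * cis ((n.+1 ^ g)%:R * beta)).
Proof.
move=> hM chi1 b0 gb ha; apply: mean_zero_approx => eta eta0.
have eta2 : 0 < eta / 2 by rewrite divr_gt0.
pose c j : R := ('C((2 ^ j).*2, 2 ^ j))%:R / 4 ^+ (2 ^ j).
have [j hj] : exists j, c j <= eta / 2.
  pose k := Num.truncn ((eta / 2) ^- 2).
  have hk : (eta / 2) ^- 2 < k.+1%:R.
    by have /andP[] := truncn_itv (ltW (exprn_gt0 2 (divr_gt0 ltr01 eta2))); rewrite div1r exprVn.
  exists k; rewrite leNgt; apply/negP => cj.
  have := central_bin_small (2 ^ k); rewrite -/(c k).
  have kk : (k.+1 <= (2 ^ k).*2.+1)%N by rewrite ltnS (leq_trans (ltnW (ltn_expl k (ltnSn 1))))// -addnn leq_addr.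
  have kr : k.+1%:R <= (2 ^ k).*2.+1%:R :> R by rewrite ler_nat.
  have e2 : (eta / 2) ^+ 2 < c k ^+ 2 by rewrite ltr_pXn2r// nnegrE ltW// (lt_trans eta2).
  have e20 : 0 < (eta / 2) ^+ 2 by rewrite exprn_gt0.
  have : 1 < (eta / 2) ^+ 2 * k.+1%:R by rewrite mulrC -ltr_pdivrMr// mul1r.
  by move: kr e2 e20; set A := _%:R; set D := c k ^+ 2; set E := (eta / 2) ^+ 2; set Q := _%:R; nra.
have [L [P hLP]] := iter_sharpen_trig j.
exists (fun n => chi n * (iter j sharpen (sin (2 * pi * ((n.+1 ^ b)%:R * alpha))))%:C%C
     * cis ((n.+1 ^ g)%:R * beta)).
  apply: mean_zero_ext (trig_poly_mean L.*2.+1 P beta hM chi1 b0 gb ha) => n.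
  by rewrite /= odd_double subr0 hLP.
have [K hK] := cos_pow_mean (2 ^ j) b0 ha eta2.
exists K => N.
pose q n := (cos (2 * pi * ((n.+1 ^ b)%:R * alpha)) ^+ 2) ^+ (2 ^ j).
apply: (@le_trans _ _ (\sum_(n < N) q n)).
  apply: ler_sum => n _; rewrite -mulrBl -mulrBr -rmorphB !cabsM cabs_cis mulr1 cabs_real.
  by rewrite (le_trans (ler_piMl _ (chi1 _)))// sqwave_approx.
have : \sum_(n < N) q n - c j * N%:R <= eta / 2 * N%:R + K.
  apply: le_trans (hK N); apply: le_trans (Re_le_cabs _); apply: le_trans (ler_norm _).
  by rewrite Re_sum/= big_split/= sum_const_ord mulrN mulrC.
have N0 : 0 <= N%:R :> R by [].
have := ler_wpM2r N0 hj; lra.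
Qed.

End SquareWave.

(** * Dyadic blocks and 2-adic classes *)

Section DyadicBlocks.
Variable R : realType.
Local Notation C := R[i].
Implicit Types (f : nat -> C).

Definition block_sign n : C := (-1) ^+ trunc_log 2 n.

Lemma block_sum f J m : (m <= 2 ^ J)%N ->
  \sum_(n < 2 ^ J + m) block_sign n * f n =
  \sum_(n < 2 ^ J) block_sign n * f n +
  (-1) ^+ J * (\sum_(n < 2 ^ J + m) f n - \sum_(n < 2 ^ J) f n).
Proof.
move=> mJ; rewrite !big_split_ord/= [X in _ * (X - _)]addrC addrK; congr (_ + _).
rewrite mulr_sumr; apply: eq_bigr => i _; congr ((-1) ^+ _ * _).
apply: trunc_log_eq => //; rewrite leq_addr/= expnS mul2n -addnn ltn_add2l.
by rewrite (leq_trans (ltn_ord i)).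
Qed.

Lemma sqr_le_exp2 J : (J ^ 2 <= 4 * 2 ^ J)%N.
Proof.
case: (leqP J 3) => [|]; first by case: J => [|[|[|[|]]]].
elim: J => // J IH; rewrite ltnS leq_eqVlt => /orP[/eqP <- //|/IH].
rewrite [(2 ^ J.+1)%N]expnS; case: J {IH} => [|[|[|J]]]; rewrite ?expnS; lia.
Qed.

(** On each dyadic block the signed sum is, up to sign, a difference of two
partial sums of [f]. The bounds form a geometric series plus a term proportional
to the number of blocks, which is logarithmic in N. *)
Lemma mean_zero_block_sign f : mean_zero f -> mean_zero (fun n => block_sign n * f n).
Proof.
move=> hf e e0; pose eta := e / 6.
have eta0 : 0 < eta by rewrite divr_gt0.
have [K0 hK0] := hf _ eta0; pose K := `|K0|.
have K_ge0 : 0 <= K by exact: normr_ge0.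
have hK N : cabs (\sum_(n < N) f n) <= eta * N%:R + K.
  by apply: (le_trans (hK0 N)); rewrite lerD2l ler_norm.
pose G N := \sum_(n < N) block_sign n * f n.
have step J m : (m <= 2 ^ J)%N -> cabs (G (2 ^ J + m)%N) <= cabs (G (2 ^ J)%N) +
    eta * (2 * 2 ^+ J + m%:R) + 2 * K.
  move=> mJ; rewrite /G block_sum// (le_trans (cabsD _ _))// -!addrA lerD2l.
  have -> : forall z : C, cabs ((-1) ^+ J * z) = cabs z.
    by move=> z; rewrite -signr_odd cabsM; case: odd; rewrite ?expr1 ?expr0 ?cabsN cabs1 mul1r.
  rewrite (le_trans (cabsB _ _))//.
  have := hK (2 ^ J + m)%N; have := hK (2 ^ J)%N; rewrite natrD natrX; lra.
have pow J : cabs (G (2 ^ J)%N) <= 3 * eta * 2 ^+ J + 2 * K * J%:R + K.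
  elim: J => [|J IH].
    rewrite expn0 /G big_ord1 /block_sign trunc_log0 expr0 mul1r.
    by have := hK 1%N; rewrite big_ord1 expr0; lra.
  rewrite expnS mul2n -addnn; have := step J (2 ^ J)%N (leqnn _).
  rewrite natrX exprS -natr1; lra.
exists (4 * K ^+ 2 / eta + 3 * K) => N; rewrite -/(G N).
have [->|N0] := posnP N.
  rewrite /G big_ord0 cabs0 mulr0 add0r addr_ge0 ?mulr_ge0 ?exprn_ge0//.
  by rewrite invr_ge0 ltW.
pose J := trunc_log 2 N.
have /andP[J1 J2] : (2 ^ J <= N < 2 ^ J.+1)%N by apply: trunc_log_bounds.
have mJ : (N - 2 ^ J <= 2 ^ J)%N by rewrite leq_subLR addnn -mul2n -expnS ltnW.
have := step J _ mJ; rewrite subnKC// natrB// natrX => h1.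
have J1r : 2 ^+ J <= N%:R :> R by rewrite -natrX ler_nat.
have h2 := pow J.
have Jsq : J%:R ^+ 2 <= 4 * N%:R :> R.
  apply: (@le_trans _ _ (4 * 2 ^+ J)); last by rewrite ler_pM2l.
  by rewrite -!natrX -natrM ler_nat sqr_le_exp2.
have h3 : 2 * K * J%:R <= eta * N%:R + 4 * K ^+ 2 / eta.
  have : 0 <= eta * (J%:R / 2 - 2 * K / eta) ^+ 2 by rewrite mulr_ge0 ?sqr_ge0// ltW.
  have -> : eta * (J%:R / 2 - 2 * K / eta) ^+ 2 =
    eta * J%:R ^+ 2 / 4 - 2 * K * J%:R + 4 * K ^+ 2 / eta by field; rewrite gt_eqF.
  have := ler_wpM2l (ltW eta0) Jsq; lra.
have -> : e = 6 * eta by rewrite /eta mulrC divfK.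
have h4 := ler_wpM2l (ltW eta0) J1r.
lra.
Qed.

(** The valuation of the integer n + 1 for which the index n stands; with this
shift its level sets are periodic from index 0 on. *)
Definition two_adic n := logn 2 n.+1.

Lemma two_adic_geE k n : (k <= two_adic n)%N = (2 ^ k %| n.+1)%N.
Proof. by rewrite pfactor_dvdn. Qed.

Lemma two_adic_periodic k :
  periodic_seq (2 ^ k.+1) (fun n => (two_adic n == k)%:R : C).
Proof.
split; first by rewrite expn_gt0.
move=> n; congr (_%:R); congr nat_of_bool.
rewrite !eqn_leq !(leqNgt _ k) !two_adic_geE -addSn.
by rewrite dvdn_addl ?dvdnn// dvdn_addl// dvdn_exp2l.
Qed.

Lemma two_adic_tail k N :
  \sum_(n < N) (k <= two_adic n)%:R <= 2 ^- k * N%:R :> R.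
Proof.
have -> : \sum_(n < N) (k <= two_adic n)%:R = (N %/ 2 ^ k)%N%:R :> R.
  rewrite divn_count_dvd natr_sum big_add1 /= big_mkord.
  by apply: eq_bigr => n _; rewrite two_adic_geE.
rewrite mulrC ler_pdivlMr ?exprn_gt0// -natrX -natrM ler_nat.
exact: leq_divM.
Qed.

End DyadicBlocks.

(** * The oscillating weight *)

Section BadWeight.
Variable R : realType.
Local Notation C := R[i].
Variables (alpha : R) (tau : nat -> nat).
Hypothesis alpha_irr : irrational_angle alpha.
Hypothesis tau_gt0 : forall k, (0 < tau k)%N.

Definition wave n := sqwave ((n.+1 ^ tau (two_adic n))%:R * alpha).

(** The valuation selects the exponent, so that each exponent in the range of
[tau] acts on a set of positive density; the block sign makes all of these classes
oscillate in phase. *)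
Definition weight n : C := block_sign R n * (wave n)%:C%C.

(** The classes with exponent [g] are removed. Of the others, those of valuation
less than [k] are handled one by one by [sqwave_uncorrelated], and the remaining
integers have density 2^-k. *)
Lemma weight_uncorrelated g beta :
  mean_zero (fun n => (tau (two_adic n) != g)%:R * (weight n * cis ((n.+1 ^ g)%:R * beta))).
Proof.
pose f n := (tau (two_adic n) != g)%:R * ((wave n)%:C%C * cis ((n.+1 ^ g)%:R * beta)).
suff : mean_zero f by move/mean_zero_block_sign; apply: mean_zero_ext => n; rewrite /weight /f; ring.
apply: mean_zero_approx => eta eta0.
have [k hk] : exists k, 2 ^- k <= eta.
  pose k := Num.truncn (eta^-1).
  have h : eta^-1 < k.+1%:R.
    by have /andP[] := truncn_itv (ltW (divr_gt0 ltr01 eta0)); rewrite div1r.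
  exists k; rewrite invf_ple ?posrE ?exprn_gt0//; apply: (le_trans (ltW h)).
  by rewrite -natrX ler_nat ltn_expl.
pose F i n := (two_adic n == i)%:R * (sqwave ((n.+1 ^ tau i)%:R * alpha))%:C%C
  * cis ((n.+1 ^ g)%:R * beta).
have hF i : tau i != g -> mean_zero (F i).
  move=> tg; apply: (sqwave_uncorrelated _ (two_adic_periodic R i)) => //.
    by move=> n; rewrite cabs_nat; case: eqP.
  by rewrite eq_sym.
exists (fun n => \sum_(i <- index_iota 0 k | tau i != g) F i n); first exact: mean_zero_sum.
exists 0 => N; rewrite addr0; apply: (@le_trans _ _ (2 ^- k * N%:R)); last first.
  by apply: ler_wpM2r.
apply: le_trans (two_adic_tail R k N); apply: ler_sum => n _.
have zero i : i != two_adic n -> F i n = 0.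
  by move=> ne; rewrite /F eq_sym (negbTE ne) !mul0r.
have [nk|nk] := ltnP (two_adic n) k.
  rewrite leNgt big_mkcond (bigD1_seq (two_adic n)) ?iota_uniq ?mem_index_iota//=.
  rewrite big1 ?addr0; last by move=> i /zero ->; rewrite if_same.
  suff -> : f n = if tau (two_adic n) != g then F (two_adic n) n else 0.
    by rewrite subrr cabs0 ltxx.
  by rewrite /f /F /wave eqxx; case: ifP => _; rewrite ?mul1r ?mul0r.
rewrite big_seq_cond big1 ?subr0; last first.
  move=> i /andP[]; rewrite mem_index_iota/= => ik _; apply: zero.
  by rewrite neq_ltn (leq_trans ik nk).
rewrite /f !cabsM cabs_cis mulr1 cabs_nat cabs_real.
by rewrite /wave /sqwave; case: ifP => _; rewrite ?normrN normr1 mulr1; case: eqP.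
Qed.

(** Half the density of the integers of valuation [k], because the square of the
sine is (1 - cos (4 pi x))/2. *)
Lemma sin_sqr_mean b k : (0 < b)%N -> exists2 c : R, 0 < c &
  mean_zero (fun n => ((two_adic n == k)%:R * sin (2 * pi * ((n.+1 ^ b)%:R * alpha)) ^+ 2)%:C%C
      - c%:C%C).
Proof.
move=> b0; pose M := (2 ^ k.+1)%N; have hM := two_adic_periodic R k.
have M0 : 0 < M%:R :> R by rewrite ltr0n expn_gt0.
pose c : R := M%:R^-1 * (\sum_(i < M) (two_adic i == k)%:R) / 2.
exists c.
  rewrite divr_gt0// mulr_gt0 ?invr_gt0//.
  have kM : ((2 ^ k).-1 < M)%N.
    by rewrite prednK ?expn_gt0// leq_exp2l.
  rewrite (bigD1 (Ordinal kM))//= ltr_pwDl ?sumr_ge0//.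
  by rewrite /two_adic prednK ?expn_gt0// pfactorK// eqxx.
have g0 : 0%N != b by rewrite neq_ltn b0.
have chi1 n : cabs ((two_adic n == k)%:R : C) <= 1 by rewrite cabs_nat; case: eqP.
have w1 := @weyl_two_powers _ _ _ b 0 alpha 0 2 hM chi1 b0 g0 alpha_irr isT.
have w2 := @weyl_two_powers _ _ _ b 0 alpha 0 (- 2%:Z) hM chi1 b0 g0 alpha_irr isT.
have := mean_zeroD (mean_zeroZ 2^-1 (periodic_mean hM)) (mean_zeroZ (- 4^-1) (mean_zeroD w1 w2)).
apply: mean_zero_ext => n; set x := _ * alpha; set d := (two_adic n == k).
rewrite mulr0 cis0 !mulr1 mulrNz -[2%:~R]/(2 : R).
have -> : (c%:C)%C = 2^-1 * (M%:R^-1 * \sum_(i < M) (two_adic i == k)%:R).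
  rewrite /c mulrC !rmorphM !fmorphV !rmorph_nat rmorph_sum/=.
  by congr (_ * (_ * _)); apply: eq_bigr => i _; rewrite rmorph_nat.
have -> : sin (2 * pi * x) ^+ 2 = (1 - cos (2 * pi * (2 * x))) / 2.
  have -> : 2 * pi * (2 * x) = (2 * pi * x) *+ 2 by ring.
  by rewrite cos_mulr2n sin2cos2; field.
have -> : (d%:R * ((1 - cos (2 * pi * (2 * x))) / 2))%:C%C =
   2^-1 * d%:R - 2^-1 * d%:R * (cos (2 * pi * (2 * x)))%:C%C :> C.
  rewrite -(rmorph_nat (real_complex R) 2) -(rmorph_nat (real_complex R) d).
  rewrite -fmorphV -!rmorphM -!rmorphB /=.
  by congr (_%:C)%C; ring.
have -> : (cos (2 * pi * (2 * x)))%:C%C = 2^-1 * (cis (2 * x) + cis (- 2 * x)) :> C.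
  rewrite mulNr -cis_conj /cis /e2pi; set t := 2 * pi * (2 * x).
  rewrite -(rmorph_nat (real_complex R) 2) -fmorphV.
  by apply/eqP; rewrite eq_complex /=; apply/andP; split; apply/eqP; field.
by field.
Qed.

(** A mean would force the block sums over [2^J, 2^(J+1)[ to be close to
2^J L. By [weight_uncorrelated] only the classes with exponent [g] matter; there,
the imaginary part is the block sign times |sin|, whose block sum is at least c 2^J
since |sin| >= sin^2 on the class [k]. So the imaginary part of [L] would be
positive by the even blocks and negative by the odd ones. *)
Lemma weight_correlated g k L : tau k = g ->
  ~ mean_zero (fun n => weight n * cis ((n.+1 ^ g)%:R * alpha) - L).
Proof.
move=> tkg hL; pose x n : R := (n.+1 ^ g)%:R * alpha.
have g0 : (0 < g)%N by rewrite -tkg.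
pose q n := (tau (two_adic n) == g)%:R * (wave n * sin (2 * pi * x n)).
pose r n := (two_adic n == k)%:R * sin (2 * pi * x n) ^+ 2.
have [c c0 hc] := sin_sqr_mean k g0.
have eta0 : 0 < c / 12 by rewrite divr_gt0.
have blk f : mean_zero f -> exists K : R, forall J,
    cabs (\sum_(m < 2 ^ J) f (m + 2 ^ J)%N) <= c / 4 * 2 ^+ J + K.
  move=> /(_ _ eta0) [K hK]; exists (2 * K) => J; rewrite sum_shift.
  rewrite (le_trans (cabsB _ _))//.
  by have := hK (2 ^ J + 2 ^ J)%N; have := hK (2 ^ J)%N; rewrite natrD natrX; lra.
have [K1 hK1] := blk _ hc.
have [K2 hK2] := blk _ (mean_zeroB hL (weight_uncorrelated g alpha)).
have rq n : r n <= q n.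
  have sq (y : R) : sin (2 * pi * y) ^+ 2 <= sqwave y * sin (2 * pi * y).
    have [h1 h2] := (sin_geN1 (2 * pi * y), sin_le1 (2 * pi * y)).
    by rewrite /sqwave; case: ifPn => [|]; rewrite -?ltNge => ?; nra.
  rewrite /r /q /wave; have [e|ne] := eqVneq (two_adic n) k.
    by rewrite e tkg eqxx !mul1r.
  rewrite mul0r; case: eqVneq => [->|_]; last by rewrite mul0r.
  by rewrite mul1r (le_trans _ (sq _))// sqr_ge0.
have key J : c / 2 * 2 ^+ J - K1 - K2 <= (-1) ^+ J * complex.Im L * 2 ^+ J.
  pose S := \sum_(m < 2 ^ J) q (m + 2 ^ J)%N.
  have hr : (c - c / 4) * 2 ^+ J - K1 <= S.
    apply: (@le_trans _ _ (\sum_(m < 2 ^ J) r (m + 2 ^ J)%N)); last exact: ler_sum.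
    have := hK1 J; have := Re_le_cabs (\sum_(m < 2 ^ J) ((r (m + 2 ^ J)%N)%:C%C - c%:C%C)).
    rewrite Re_sum/= big_split/= sum_const_ord natrX.
    by rewrite ler_norml => /andP[]; lra.
  have hq : `|(-1) ^+ J * S - 2 ^+ J * complex.Im L| <= c / 4 * 2 ^+ J + K2.
    apply: le_trans (hK2 J); apply: le_trans (Im_le_cabs _).
    rewrite Im_sum le_eqVlt; apply/orP; left; apply/eqP; congr `|_|.
    rewrite -natrX -sum_const_ord mulr_sumr -sumrB; apply: eq_bigr => m _.
    set n := (m + 2 ^ J)%N.
    have -> : weight n * cis ((n.+1 ^ g)%:R * alpha) - L -
       (tau (two_adic n) != g)%:R * (weight n * cis ((n.+1 ^ g)%:R * alpha)) =
       (tau (two_adic n) == g)%:R * (weight n * cis ((n.+1 ^ g)%:R * alpha)) - L.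
      by case: eqP => _; rewrite ?mul1r ?mul0r ?subr0 ?sub0r// addrAC subrr add0r.
    rewrite /weight; have -> : block_sign R n = ((-1) ^+ J)%:C%C.
      rewrite rmorphXn rmorphN1; congr (_ ^+ _); apply: trunc_log_eq => //.
      by rewrite /n leq_addl expnS mul2n -addnn ltn_add2r ltn_ord.
    rewrite ImD ImN /q /cis /e2pi -/(x n).
    rewrite -(rmorph_nat (real_complex R)) /=; ring.
  have [sg|sg] : (-1) ^+ J = 1 :> R \/ (-1) ^+ J = -1 :> R.
    by rewrite -signr_odd; case: odd; rewrite ?expr0 ?expr1; [right|left].
    by move: hq; rewrite sg !mul1r ler_norml => /andP[]; lra.
  by move: hq; rewrite sg !mulN1r ler_norml => /andP[]; lra.
(* From block [j] on, the constants are dominated by the main term. *)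
pose j := Num.truncn ((`|K1| + `|K2|) / (c / 2)).
have hj : `|K1| + `|K2| < c / 2 * j.+1%:R.
  rewrite mulrC -ltr_pdivrMr ?divr_gt0//.
  by have /andP[] := truncn_itv (divr_ge0 (addr_ge0 (normr_ge0 K1) (normr_ge0 K2)) (ltW (divr_gt0 c0 (ltr0n R 2)))).
have big J : (j < J)%N -> 0 < (-1) ^+ J * complex.Im L.
  move=> jJ; have p0 : 0 < 2 ^+ J :> R by rewrite exprn_gt0.
  rewrite -(pmulr_lgt0 _ p0); apply: lt_le_trans (key J).
  have : j.+1%:R <= 2 ^+ J :> R by rewrite -natrX ler_nat (leq_trans jJ)// ltnW// ltn_expl.
  have := ler_norm K1; have := ler_norm K2; nra.
have := big j.+1 (ltnSn _); have := big j.+2 (leqnSn _).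
by rewrite exprS mulN1r mulNr; lra.
Qed.

End BadWeight.

(** * From weights to increasing sequences *)

Section Averages.
Variable R : realType.
Local Notation C := R[i].
Implicit Types (F : nat -> C) (L : C).

(** This lemma and the next one identify convergence of the averages in [R[i]^o]
with the existence of a mean. *)
Lemma mean_cvg F L : mean_zero (fun n => F n.+1 - L) ->
  cvgn (fun N : nat => N%:R^-1 * \sum_(1 <= n < N.+1) F n : R[i]^o).
Proof.
move=> hF; apply/cvg_ex; exists (L : R[i]^o); apply/cvgrPdist_le => e e0.
have [r r0 ->] : exists2 r : R, 0 < r & e = r%:C%C.
  by move: e e0 => [r i]; rewrite ltcE/= => /andP[/eqP -> r0]; exists r.
have r2 : 0 < r / 2 by rewrite divr_gt0.
have [K hK] := hF _ r2; pose N0 := Num.truncn (2 * `|K| / r).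
exists N0.+1 => // N /= N0N.
have Npos : 0 < N%:R :> R by rewrite ltr0n (leq_trans _ N0N).
have NC : N%:R != 0 :> C by rewrite pnatr_eq0 -lt0n (leq_trans _ N0N).
rewrite cabsE lecR -cabsN opprB.
have -> : N%:R^-1 * \sum_(1 <= n < N.+1) F n - L =
    N%:R^-1 * \sum_(n < N) (F n.+1 - L).
  by rewrite big_add1/= big_mkord sumrB sum_const_ord mulrBr mulKf.
rewrite cabsM cabsV cabs_nat mulrC ler_pdivrMr//; apply: (le_trans (hK N)).
have : 2 * `|K| / r < N%:R.
  have /andP[_ h] := truncn_itv (divr_ge0 (mulr_ge0 (ler0n R 2) (normr_ge0 K)) (ltW r0)).
  by rewrite (lt_le_trans h)// ler_nat.
rewrite ltr_pdivrMr// => h; have := ler_norm K; lra.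
Qed.

Lemma cvg_mean F :
  cvgn (fun N : nat => N%:R^-1 * \sum_(1 <= n < N.+1) F n : R[i]^o) ->
  exists L, mean_zero (fun n => F n.+1 - L).
Proof.
move=> /cvg_ex[/= L /cvgrPdist_le hL]; exists L => eta eta0.
have eC : 0 < eta%:C%C :> C by rewrite ltcR.
have [N0 _ hN0] := hL _ eC.
exists (\sum_(n < N0) cabs (F n.+1 - L)) => N.
have S0 : 0 <= \sum_(n < N0) cabs (F n.+1 - L).
  by apply: sumr_ge0 => i _; exact: cabs_ge0.
have [NN0|N0N] := ltnP N N0.
  apply: (le_trans (cabs_sum _ _ _)).
  rewrite -(subnKC (ltnW NN0)) big_split_ord/=.
  have := @sumr_ge0 R _ (index_enum 'I_(N0 - N)) xpredT
    (fun n => cabs (F (N + n).+1 - L)) (fun _ _ => cabs_ge0 _).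
  have : 0 <= eta * N%:R by rewrite mulr_ge0// ltW.
  lra.
have [->|Npos] := posnP N; first by rewrite big_ord0 cabs0 mulr0 add0r.
have NC : N%:R != 0 :> C by rewrite pnatr_eq0 -lt0n.
have NR : 0 < N%:R :> R by rewrite ltr0n.
have := hN0 N N0N; rewrite /= cabsE lecR -cabsN opprB.
have -> : N%:R^-1 * \sum_(1 <= n < N.+1) F n - L =
    N%:R^-1 * \sum_(n < N) (F n.+1 - L).
  by rewrite big_add1/= big_mkord sumrB sum_const_ord mulrBr mulKf.
rewrite cabsM cabsV cabs_nat mulrC ler_pdivrMr// => h; lra.
Qed.

(** The dummy value [s 0 = 0] makes the gaps between consecutive values of [s]
cover every [N], so that partial sums at an arbitrary [N] can be transferred. *)
Lemma enumeration (a : nat -> bool) : (forall n, exists2 m, (n <= m)%N & a m) ->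
  exists s : nat -> nat, [/\ s 0%N = 0%N, forall k, (s k < s k.+1)%N &
    forall N k F, (s k <= N < s k.+1)%N ->
      \sum_(n < N) (a n)%:R * F n.+1 = \sum_(i < k) F (s i.+1)].
Proof.
move=> inf.
have ex n : exists m, (n <= m)%N && a m by have [m nm am] := inf n; exists m; rewrite nm.
pose s k := iter k (fun n => (ex_minn (ex n)).+1) 0%N.
have sS k : s k.+1 = (ex_minn (ex (s k))).+1 by [].
have lt k : (s k < s k.+1)%N by rewrite sS; case: ex_minnP => m /andP[].
exists s; split=> // N k F.
have gap k' M : (s k' <= M < s k'.+1)%N ->
    \sum_(n < M) (a n)%:R * F n.+1 = \sum_(n < s k') (a n)%:R * F n.+1.
  rewrite sS; case: ex_minnP => m _ hm /andP[sM Mm].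
  rewrite -(subnKC sM) big_split_ord/= [X in _ + X]big1 ?addr0// => i _.
  case: (boolP (a (s k' + i)%N)) => [ai|_]; last by rewrite mul0r.
  have := hm (s k' + i)%N; rewrite leq_addr ai => /(_ isT).
  have := ltn_ord i; lia.
move=> /gap ->; elim: k => [|k IH]; first by rewrite !big_ord0.
rewrite [RHS]big_ord_recr -IH.
have [m am e] : exists2 m, a m & s k.+1 = m.+1.
  by rewrite sS; case: ex_minnP => m /andP[_ am] _; exists m.
have := lt k; rewrite e ltnS => skm.
by rewrite big_ord_recr am mul1r /= (gap k)// skm e /=.
Qed.

Lemma density_infinite (a : nat -> bool) (delta : R) : 0 < delta ->
  mean_zero (fun n => (a n)%:R - delta%:C%C) -> forall n, exists2 m, (n <= m)%N & a m.
Proof.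
move=> d0 ha n; apply: contrapT => noa.
have [K hK] := ha (delta / 2) (divr_gt0 d0 (ltr0n R 2)).
pose p := Num.truncn (2 * (`|K| + n%:R) / delta).
have hp : 2 * (`|K| + n%:R) / delta < p.+1%:R.
  have := truncn_itv (divr_ge0 (mulr_ge0 (ler0n R 2) (addr_ge0 (normr_ge0 K) (ler0n R n))) (ltW d0)).
  by case/andP.
rewrite ltr_pdivrMr// in hp.
have := hK (n + p.+1)%N; rewrite sumrB sum_const_ord big_split_ord/=.
rewrite [X in _ + X - _]big1 ?addr0; last first.
  move=> i _; case: (boolP (a _)) => // ai.
  by exfalso; apply: noa; exists (n + i)%N; rewrite ?leq_addr.
have h1 : cabs (\sum_(i < n) (a i)%:R : C) <= n%:R.
  by apply: (@cabs_sum_le _ (fun i => (a i)%:R)) => i; rewrite cabs_nat; case: (a i).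
set S := \sum_(i < n) _ in h1 *.
have := cabsB S (S - (n + p.+1)%:R * delta%:C%C); rewrite opprB addrC subrK.
rewrite cabsM cabs_nat cabs_real gtr0_norm// natrD.
have := ler_norm K; have : 0 <= delta * n%:R by rewrite mulr_ge0// ltW.
lra.
Qed.

(** Sums along the enumeration up to index k are sums against the indicator up
to s k, and s k is comparable with k since the density is positive. Both
directions reduce to the mean of a (F - M), where M is the mean along the
enumeration and F the phase. *)
Lemma averages_along_set (a : nat -> bool) (delta : R) : 0 < delta ->
  mean_zero (fun n => (a n)%:R - delta%:C%C) ->
  exists s : nat -> nat, s 0%N = 0%N /\ (forall k, (s k < s k.+1)%N) /\
    forall g (alpha : R), cvgn (exp_avg s g alpha) <->
      exists L, mean_zero (fun n => (a n)%:R * cis ((n.+1 ^ g)%:R * alpha) - L).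
Proof.
move=> d0 ha.
have [s [s0 slt hs]] := enumeration (density_infinite d0 ha).
exists s; split=> //; split=> // g alpha.
pose F n := cis ((n ^ g)%:R * alpha).
pose Fs n := F (s n).
have k_le k : (k <= s k)%N by elim: k => // k IH; exact: leq_ltn_trans IH (slt k).
have dC : delta%:C%C != 0 :> C by rewrite eq_complex /= gt_eqF.
split=> [/(@cvg_mean Fs)[L hL]|[L hL]].
  exists (L * delta%:C%C).
  have hM : mean_zero (fun n => (a n)%:R * (F n.+1 - L)).
    move=> eta eta0; have [K hK] := hL _ eta0; exists K => N.
    have [k kN] : exists k, (s k <= N < s k.+1)%N.
      have ex : exists k, (s k <= N)%N by exists 0%N; rewrite s0.
      have bd k : (s k <= N)%N -> (k <= N)%N by exact: leq_trans.
      case: (ex_maxnP ex bd) => k kN hk; exists k; rewrite kN /= ltnNge.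
      by apply/negP => /hk; rewrite ltnn.
    rewrite (hs N k (fun n => F n - L))//; apply: (le_trans (hK k)).
    rewrite lerD2r ler_pM2l// ler_nat.
    by case/andP: kN => + _; exact: leq_trans.
  by apply: mean_zero_ext (mean_zeroD hM (mean_zeroZ L ha)) => n; rewrite /F; ring.
apply: (@mean_cvg Fs (L / delta%:C%C)).
pose M := L / delta%:C%C.
have hf : mean_zero (fun n => (a n)%:R * (F n.+1 - M)).
  apply: mean_zero_ext (mean_zeroB hL (mean_zeroZ M ha)) => n; rewrite /F /M.
  by field.
move=> eta eta0.
have eta' : 0 < eta * delta / 2 by rewrite divr_gt0// mulr_gt0.
have [K hK] := hf _ eta'.
have [K2 hK2] := ha (delta / 2) (divr_gt0 d0 (ltr0n R 2)).
exists (K + eta * K2) => k.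
have sk : (s k <= s k < s k.+1)%N by rewrite leqnn slt.
have -> : \sum_(n < k) (Fs n.+1 - L / delta%:C%C) =
    \sum_(n < s k) (a n)%:R * (F n.+1 - M).
  by rewrite (hs _ k (fun n => F n - M)).
apply: (le_trans (hK _)).
have hk : (delta / 2) * (s k)%:R <= k%:R + K2.
  have := hK2 (s k); rewrite sumrB sum_const_ord.
  have -> : \sum_(i < s k) (a i)%:R = k%:R :> C.
    under eq_bigr do rewrite -[_%:R]mulr1.
    by rewrite (hs _ k (fun=> 1))// sum_const_ord mulr1.
  have := cabsB k%:R (k%:R - (s k)%:R * delta%:C%C : C); rewrite opprB addrC subrK.
  rewrite cabsM !cabs_nat cabs_real gtr0_norm//; lra.
have := ler_wpM2l (ltW eta0) hk; lra.
Qed.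

End Averages.

(** * Construction of the sequence *)

Theorem theoremA (R : realType) (B : set nat)
    (B_pos : forall b : nat, B b -> (0 < b)%N) :
  exists s : nat -> nat,
    [/\ (forall n : nat, (1 <= n)%N -> (0 < s n)%N),
        (forall m n : nat, (1 <= m)%N -> (m < n)%N -> (s m < s n)%N),
        (forall g : nat, (1 <= g)%N -> ~ B g ->
           forall alpha : R, cvgn (exp_avg s g alpha))
      & (forall b : nat, B b ->
           exists alpha : R, ~ cvgn (exp_avg s b alpha))].
Proof.
suff [a [delta [d0 ha good bad]]] : exists (a : nat -> bool) (delta : R), [/\ 0 < delta,
    mean_zero (fun n => (a n)%:R - delta%:C%C),
    forall g, ~ B g -> forall alpha : R, exists L,
      mean_zero (fun n => (a n)%:R * cis ((n.+1 ^ g)%:R * alpha) - L) &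
    forall b, B b -> exists alpha : R, ~ exists L,
      mean_zero (fun n => (a n)%:R * cis ((n.+1 ^ b)%:R * alpha) - L)].
  have [s [s0 [slt hs]]] := averages_along_set d0 ha.
  have smono : {homo s : m n / (m < n)%N} by apply: homo_ltn => //; exact: ltn_trans.
  exists s; split=> [n n0|m n _|g _ Bg alpha|b Bb].
  - by rewrite -s0; exact: smono.
  - exact: smono.
  - by apply/hs; exact: good.
  - by have [alpha halpha] := bad b Bb; exists alpha => /hs.
have [[b0 Bb0]|B0] := pselect (exists b, B b); last first.
  exists xpredT, 1; split=> // [|g _ alpha|b Bb].
  - by apply: mean_zero_ext (@mean_zero0 R) => n; rewrite subrr.
  - have [L hL] := weyl_mean g alpha; exists L.
    by apply: mean_zero_ext hL => n; rewrite mul1r.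
  - by exfalso; apply: B0; exists b.
have [alpha alpha_irr] := exists_irrational_angle R.
(* Valuations outside [B] receive an arbitrary exponent of [B]: every class must
   carry some sign, and an exponent outside [B] must not oscillate. *)
pose tau k := if `[< B k >] then k else b0.
have Btau k : B (tau k) by rewrite /tau; case: ifPn => // /asboolP.
have tau_gt0 k : (0 < tau k)%N by exact: B_pos.
pose w := weight alpha tau.
have w_sgn n : w n = 1 \/ w n = -1.
  rewrite /w /weight /block_sign -signr_odd /wave /sqwave.
  by case: (odd _); case: ifP => _; rewrite ?expr0 ?expr1 ?rmorphN1 ?rmorph1 ?mulN1r ?mul1r ?opprK; [right|left|left|right].
have N11 : (-1 == 1 :> R[i]) = false.
  by apply/negbTE; rewrite -subr_eq0 -opprD oppr_eq0 -mulr2n pnatr_eq0.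
pose a n := w n == 1.
have aE n : (a n)%:R = 2^-1 * (1 + w n) :> R[i].
  rewrite /a; have [->|->] := w_sgn n; first by rewrite eqxx mulVf// pnatr_eq0.
  by rewrite N11 subrr mulr0.
have wgood g beta : ~ B g -> mean_zero (fun n => w n * cis ((n.+1 ^ g)%:R * beta)).
  move=> Bg; apply: mean_zero_ext (weight_uncorrelated alpha_irr tau_gt0 g beta) => n.
  by case: eqVneq => [e|_]; [exfalso; apply: Bg; rewrite -e|rewrite mul1r].
exists a, 2^-1; split=> [|| g Bg beta|b Bb]; first by rewrite invr_gt0.
(* The density is the case of exponent 0, which is never in [B]. *)
- have B0 : ~ B 0%N by move=> /B_pos.
  apply: mean_zero_ext (mean_zeroZ 2^-1 (wgood 0%N 0 B0)) => n.
  by rewrite mulr0 cis0 mulr1 aE fmorphV rmorph_nat mulrDr mulr1 addrAC subrr add0r.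
- have [L hL] := weyl_mean g beta; exists (2^-1 * L).
  apply: mean_zero_ext (mean_zeroZ 2^-1 (mean_zeroD hL (wgood g beta Bg))) => n.
  by rewrite aE; ring.
- exists alpha => -[L hL]; have [L' hL'] := weyl_mean b alpha.
  have tb : tau b = b by rewrite /tau; case: asboolP.
  apply: (@weight_correlated R alpha tau alpha_irr tau_gt0 b b (2 * L - L') tb).
  apply: mean_zero_ext (mean_zeroB (mean_zeroZ 2 hL) hL') => n; rewrite aE -/(w n).
  by field.
Qed.
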